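(* Let $\alpha^*$ be a $B$-$R^*$ associated curve of $\alpha$ (with respect to the real numbers $e,f$), and let $\{T^*,N^*,B^*\}$ be the Frenet frame of $\alpha^*$. Then the Frenet frames of $\alpha$ and $\alpha^*$ are related by $$T^*=\frac{1}{\sqrt{e^2+f^2}}\left(\frac{f}{\sqrt{1+\lambda^2\tau^2}}\,T-\frac{\lambda\tau f}{\sqrt{1+\lambda^2\tau^2}}\,N+e\,B\right),$$ $$N^*=\frac{ef}{\sqrt{e^2+f^2}}\left(\frac{Y\lambda'+Z\lambda\tau}{Z\lambda'}\,T+\frac{-X\lambda+Z}{Z\lambda'}\,N\right),$$ $$B^*=\frac{f}{\sqrt{e^2+f^2}}\left(\frac{X}{Z}\,T+\frac{Y}{Z}\,N+B\right),$$ where $$X=-\lambda\tau(-\lambda\tau^2+\lambda'')-\lambda'(-\lambda\tau'-2\lambda'\tau+\kappa),\quad Y=\lambda\tau^2-\lambda''+\lambda'\lambda\tau\kappa,\quad Z=-\lambda\tau'-2\lambda'\tau+\kappa+\lambda^2\tau^2\kappa.$$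
   Context: $\alpha$ and $\alpha^*$ are differentiable curves in $E^3$; $\alpha$ is parametrized by arc length $s$ and has Frenet frame $\{T,N,B\}$, curvature $\kappa$ and torsion $\tau$, with $T'=\kappa N$, $N'=-\kappa T+\tau B$, $B'=-\tau N$. The Frenet frame of a curve $\gamma$ is given by $\gamma'/\|\gamma'\|$ (tangent), $(\gamma'\wedge\gamma'')/\|\gamma'\wedge\gamma''\|$ (binormal), and principal normal = binormal $\wedge$ tangent. For arbitrary real numbers $e,f$ put $R^*=\frac{eT^*+fB^*}{\sqrt{e^2+f^2}}$, a unit vector lying in the rectifying plane of $\alpha^*$. The curve $\alpha^*$ is called a $B$-$R^*$ associated curve of $\alpha$ if the binormal $B$ of $\alpha$ is linearly dependent with the vector $R^*$. The function $\lambda$ of $s$ is the one for which $\alpha^*=\alpha+\lambda B$; primes denote derivatives with respect to $s$.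
   Formalization: The printed formulas fail (unit circle, λ=s, e=f=1 or e=f=−1): T* and B* get an extra factor sgn(f); N* gets coefficient ef/(e²+f²) and N-component (−Xλ′+Z)/(Zλ′), and is stated where λ′≠0; (e,f)≠(0,0) is assumed. *)

(* Defs.v *)
From mathcomp Require Export all_boot all_order all_algebra.
From mathcomp Require Export all_classical all_reals all_analysis.
Export numFieldNormedType.Exports.
Set Implicit Arguments.
Unset Strict Implicit.
Unset Printing Implicit Defensive.
Import Order.TTheory GRing.Theory Num.Theory.
Local Open Scope ring_scope.
Local Open Scope classical_set_scope.

(* The library's norm on 'rV[R]_3 is the sup norm, so the Euclidean norm needs
   its own definition; the topology, hence the derivative, is the same. *)
Definition enorm (R : realType) (u : 'rV[R]_3) : R :=
  Num.sqrt (\sum_(i < 3) u 0 i ^+ 2).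

(* Indices are added in 'I_3, that is, modulo 3. *)
Definition cross (R : realType) (u v : 'rV[R]_3) : 'rV[R]_3 :=
  \row_(k < 3) (u 0 (k + 1) * v 0 (k + 2) - u 0 (k + 2) * v 0 (k + 1)).

Definition twice_derivable (R : realType) (V : normedModType R)
    (I : set R) (g : R -> V) : Prop :=
  forall s : R, I s -> derivable g s 1 /\ derivable (derive1 g) s 1.

Definition frenet_T (R : realType) (g : R -> 'rV[R]_3) (s : R) : 'rV[R]_3 :=
  (enorm (derive1 g s))^-1 *: derive1 g s.

Definition frenet_B (R : realType) (g : R -> 'rV[R]_3) (s : R) : 'rV[R]_3 :=
  (enorm (cross (derive1 g s) (derive1n 2 g s)))^-1
    *: cross (derive1 g s) (derive1n 2 g s).

Definition frenet_N (R : realType) (g : R -> 'rV[R]_3) (s : R) : 'rV[R]_3 :=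
  cross (frenet_B g s) (frenet_T g s).

(* The cross product condition makes all the vectors normalised above nonzero,
   so that the Frenet frame exists; in particular the curve is regular. *)
Definition frenet_curve (R : realType) (I : set R) (g : R -> 'rV[R]_3) : Prop :=
  twice_derivable I g /\
  forall s : R, I s -> cross (derive1 g s) (derive1n 2 g s) != 0.

Definition unit_speed (R : realType) (I : set R) (g : R -> 'rV[R]_3) : Prop :=
  forall s : R, I s -> enorm (derive1 g s) = 1.

(* The frame being orthonormal, these equations determine kappa and tau on I. *)
Definition frenet_equations (R : realType) (I : set R) (g : R -> 'rV[R]_3)
    (kappa tau : R -> R) : Prop :=
  forall s : R, I s ->
    [/\ is_derive s 1 (frenet_T g) (kappa s *: frenet_N g s),
        is_derive s 1 (frenet_N g)
          (- kappa s *: frenet_T g s + tau s *: frenet_B g s)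
      & is_derive s 1 (frenet_B g) (- tau s *: frenet_N g s)].

Definition Rstar (R : realType) (e f : R) (g : R -> 'rV[R]_3) (s : R) :
    'rV[R]_3 :=
  (Num.sqrt (e ^+ 2 + f ^+ 2))^-1 *: (e *: frenet_T g s + f *: frenet_B g s).

(* [Rstar e f] is a unit vector only if (e, f) <> (0, 0). *)
Definition BR_associated (R : realType) (I : set R) (e f : R)
    (alpha alphas : R -> 'rV[R]_3) : Prop :=
  (e, f) <> (0, 0) /\
  forall s : R, I s -> ~~ free [:: frenet_B alpha s; Rstar e f alphas s].

Definition coefX (R : realType) (kappa tau lambda : R -> R) (s : R) : R :=
  - lambda s * tau s * (- lambda s * tau s ^+ 2 + derive1n 2 lambda s)
  - derive1 lambda s
    * (- lambda s * derive1 tau s - 2 * derive1 lambda s * tau s + kappa s).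

Definition coefY (R : realType) (kappa tau lambda : R -> R) (s : R) : R :=
  lambda s * tau s ^+ 2 - derive1n 2 lambda s
  + derive1 lambda s * lambda s * tau s * kappa s.

Definition coefZ (R : realType) (kappa tau lambda : R -> R) (s : R) : R :=
  - lambda s * derive1 tau s - 2 * derive1 lambda s * tau s + kappa s
  + lambda s ^+ 2 * tau s ^+ 2 * kappa s.

(* Main.v *)
(* In the frame {T, N, B} one has alphas' = (1, -lambda tau, lambda') and
   alphas' x alphas'' = (X, Y, Z).  As R* is parallel to B, its T and N components
   vanish, which yields f <> 0, Y = -lambda tau X and
   f^2 lambda'^2 = e^2 (1 + lambda^2 tau^2).  Differentiating the last equation
   and comparing with the second one gives lambda tau = 0, hence also
   lambda' tau = lambda tau' = 0.  So in fact Z = kappa > 0, Y = 0,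
   X = - lambda' kappa and e = f lambda': the sign of R* relative to B is that of f,
   and the formulas reduce to identities in f, lambda' and kappa. *)
Require Import Defs.
From mathcomp Require Import ring lra.
Set Implicit Arguments.
Unset Strict Implicit.
Unset Printing Implicit Defensive.
Import Order.TTheory GRing.Theory Num.Theory.
Local Open Scope ring_scope.
Local Open Scope classical_set_scope.

(** * Dot and cross products in coordinates *)

Definition dot (R : realType) (u v : 'rV[R]_3) : R :=
  \sum_(i < 3) u 0 i * v 0 i.

Lemma dotE (R : realType) (u v : 'rV[R]_3) :
  dot u v = u 0 0 * v 0 0 + u 0 1 * v 0 1 + u 0 2 * v 0 2.
Proof.
rewrite /dot !big_ord_recl big_ord0 addr0 addrA.
by congr (_ + u 0 _ * v 0 _ + u 0 _ * v 0 _); apply/val_inj.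
Qed.

Lemma row3P (R : Type) (u v : 'rV[R]_3) :
  u 0 0 = v 0 0 -> u 0 1 = v 0 1 -> u 0 2 = v 0 2 -> u = v.
Proof.
move=> h0 h1 h2; apply/rowP => -[[|[|[|//]]] i3].
- by rewrite (_ : Ordinal i3 = 0) //; apply/val_inj.
- by rewrite (_ : Ordinal i3 = 1) //; apply/val_inj.
- by rewrite (_ : Ordinal i3 = 2) //; apply/val_inj.
Qed.

Lemma crossE (R : realType) (u v : 'rV[R]_3) :
  [/\ cross u v 0 0 = u 0 1 * v 0 2 - u 0 2 * v 0 1,
      cross u v 0 1 = u 0 2 * v 0 0 - u 0 0 * v 0 2
    & cross u v 0 2 = u 0 0 * v 0 1 - u 0 1 * v 0 0].
Proof.
split; rewrite mxE.
- by congr (u 0 _ * v 0 _ - u 0 _ * v 0 _); apply/val_inj.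
- by congr (u 0 _ * v 0 _ - u 0 _ * v 0 _); apply/val_inj.
- by congr (u 0 _ * v 0 _ - u 0 _ * v 0 _); apply/val_inj.
Qed.

Lemma cross0E (R : realType) (u v : 'rV[R]_3) :
  cross u v 0 0 = u 0 1 * v 0 2 - u 0 2 * v 0 1.
Proof. by have [] := crossE u v. Qed.

Lemma cross1E (R : realType) (u v : 'rV[R]_3) :
  cross u v 0 1 = u 0 2 * v 0 0 - u 0 0 * v 0 2.
Proof. by have [] := crossE u v. Qed.

Lemma cross2E (R : realType) (u v : 'rV[R]_3) :
  cross u v 0 2 = u 0 0 * v 0 1 - u 0 1 * v 0 0.
Proof. by have [] := crossE u v. Qed.

Ltac row3_ring := apply: row3P;
  rewrite ?(cross0E, cross1E, cross2E, dotE) ?(cross0E, cross1E, cross2E, mxE); ring.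

Lemma enormE (R : realType) (u : 'rV[R]_3) : enorm u = Num.sqrt (dot u u).
Proof. by []. Qed.

Lemma dot_ge0 (R : realType) (u : 'rV[R]_3) : 0 <= dot u u.
Proof. by rewrite dotE; nra. Qed.

Lemma enorm_gt0 (R : realType) (u : 'rV[R]_3) : u != 0 -> 0 < enorm u.
Proof.
move=> u0; rewrite enormE sqrtr_gt0 lt_def dot_ge0 andbT.
apply: contra_neq u0 => /eqP; rewrite dotE => /eqP uu.
by apply: row3P; rewrite mxE; nra.
Qed.

Lemma sqr_enorm (R : realType) (u : 'rV[R]_3) : enorm u ^+ 2 = dot u u.
Proof. by rewrite enormE sqr_sqrtr // dot_ge0. Qed.

Lemma dotZZ (R : realType) (a b : R) (u v : 'rV[R]_3) :
  dot (a *: u) (b *: v) = a * b * dot u v.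
Proof. by rewrite !dotE !mxE; ring. Qed.

Lemma dot_normalized (R : realType) (u : 'rV[R]_3) : u != 0 ->
  dot ((enorm u)^-1 *: u) ((enorm u)^-1 *: u) = 1.
Proof.
move=> u0; have ug := enorm_gt0 u0; rewrite dotZZ -sqr_enorm.
by field; rewrite gt_eqF.
Qed.

Lemma cross0v (R : realType) (u : 'rV[R]_3) : cross 0 u = 0.
Proof. row3_ring. Qed.

Lemma crossZZ (R : realType) (a b : R) (u v : 'rV[R]_3) :
  cross (a *: u) (b *: v) = (a * b) *: cross u v.
Proof. row3_ring. Qed.

Lemma dot_crossl (R : realType) (u v : 'rV[R]_3) : dot u (cross u v) = 0.
Proof. by rewrite dotE cross0E cross1E cross2E; ring. Qed.

Lemma cross_crossr (R : realType) (u v w : 'rV[R]_3) :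
  cross u (cross v w) = dot u w *: v - dot u v *: w.
Proof. row3_ring. Qed.

Lemma dot_cross_cross (R : realType) (u v : 'rV[R]_3) :
  dot (cross u v) (cross u v) = dot u u * dot v v - dot u v ^+ 2.
Proof. by rewrite !dotE cross0E cross1E cross2E; ring. Qed.

(** * Positively oriented orthonormal frames *)

Definition is_frame (R : realType) (T N B : 'rV[R]_3) : Prop :=
  [/\ dot T T = 1, dot B B = 1, dot T B = 0 & N = cross B T].

Section frame.
Variables (R : realType) (T N B : 'rV[R]_3).
Hypothesis frameTNB : is_frame T N B.

Lemma frame_dot : [/\ dot N N = 1, dot T N = 0 & dot N B = 0].
Proof.
have [TT BB TB ->] := frameTNB; split; first 1 last.
- by rewrite dotE cross0E cross1E cross2E; ring.
- by rewrite dotE cross0E cross1E cross2E; ring.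
- have BT : dot B T = 0 by rewrite -TB !dotE; ring.
  by rewrite dot_cross_cross TT BB BT; ring.
Qed.

Lemma frame_cross : [/\ cross T N = B, cross N B = T & cross B T = N].
Proof.
have [TT BB TB ->] := frameTNB; split=> //.
- by rewrite cross_crossr TT TB scale1r scale0r subr0.
- have -> : cross (cross B T) B = cross B (cross T B) by row3_ring.
  have -> : cross B (cross T B) = dot B B *: T - dot T B *: B by row3_ring.
  by rewrite BB TB scale1r scale0r subr0.
Qed.

Lemma dot_frame (a b c a' b' c' : R) :
  dot (a *: T + b *: N + c *: B) (a' *: T + b' *: N + c' *: B) =
  a * a' + b * b' + c * c'.
Proof.
have [TT BB TB _] := frameTNB; have [NN TN NB] := frame_dot.
transitivity (a * a' * dot T T + b * b' * dot N N + c * c' * dot B B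
    + (a * b' + a' * b) * dot T N + (a * c' + a' * c) * dot T B
    + (b * c' + b' * c) * dot N B); first by rewrite !dotE !mxE; ring.
by rewrite TT NN BB TN TB NB; ring.
Qed.

Lemma cross_frame (a b c a' b' c' : R) :
  cross (a *: T + b *: N + c *: B) (a' *: T + b' *: N + c' *: B) =
  (b * c' - c * b') *: T + (c * a' - a * c') *: N + (a * b' - b * a') *: B.
Proof.
have [TN NB BT] := frame_cross.
transitivity ((b * c' - c * b') *: cross N B + (c * a' - a * c') *: cross B T
    + (a * b' - b * a') *: cross T N); first by row3_ring.
by rewrite TN NB BT.
Qed.

Lemma enorm_frame (a b c : R) :
  enorm (a *: T + b *: N + c *: B) = Num.sqrt (a ^+ 2 + b ^+ 2 + c ^+ 2).
Proof. by rewrite enormE dot_frame -!expr2. Qed.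

(** Each coordinate is recovered by taking the dot product with the corresponding frame vector. *)
Lemma frame_inj (a b c a' b' c' : R) :
  a *: T + b *: N + c *: B = a' *: T + b' *: N + c' *: B ->
  [/\ a = a', b = b' & c = c'].
Proof.
move=> eq_abc; split.
- have := congr1 (fun u => dot u (1 *: T + 0 *: N + 0 *: B)) eq_abc.
  by rewrite !dot_frame; lra.
- have := congr1 (fun u => dot u (0 *: T + 1 *: N + 0 *: B)) eq_abc.
  by rewrite !dot_frame; lra.
- have := congr1 (fun u => dot u (0 *: T + 0 *: N + 1 *: B)) eq_abc.
  by rewrite !dot_frame; lra.
Qed.

End frame.

Lemma frenet_curve_frame (R : realType) (I : set R) (g : R -> 'rV[R]_3)
    (s : R) : frenet_curve I g -> I s ->
  is_frame (frenet_T g s) (frenet_N g s) (frenet_B g s).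
Proof.
move=> [_ /(_ s) crossN0] Is; have {}crossN0 := crossN0 Is.
split=> //; rewrite /frenet_T /frenet_B.
- apply: dot_normalized; apply: contra_neq crossN0 => ->; exact: cross0v.
- exact: dot_normalized.
- by rewrite dotZZ dot_crossl mulr0.
Qed.

(** * Derivatives along the parameter *)

Lemma is_derive_scale (R : realType) (n : nat) (h : R -> R)
    (g : R -> 'rV[R]_n) (s dh : R) (dg : 'rV[R]_n) :
  is_derive s 1 h dh -> is_derive s 1 g dg ->
  is_derive s 1 (fun x => h x *: g x) (h s *: dg + dh *: g s).
Proof.
move=> dhs dgs; have [h_s hE] := dhs; have [g_s gE] := dgs.
(* A matrix-valued function is derivable exactly when its entries are, so the claim reduces to the
   scalar product rule. *)
have gD i j : is_derive s 1 (fun x => g x i j) (dg i j).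
  apply: DeriveDef; first exact: (proj1 (derivable_mxP g s 1)).
  by rewrite -gE derive_mx // mxE.
have hgD i j : is_derive s 1 (fun x => (h x *: g x) i j)
    ((h s *: dg + dh *: g s) i j).
  have -> : (fun x => (h x *: g x) i j) = (h * (fun x => g x i j)).
    by apply/funext => x; rewrite mxE.
  by apply: is_derive_eq; rewrite !mxE /GRing.scale /= (mulrC dh).
have hg : derivable (fun x => h x *: g x) s 1.
  by apply/derivable_mxP => i j; have [] := hgD i j.
apply: DeriveDef => //; rewrite derive_mx //; apply/matrixP => i j.
by rewrite mxE derive_val.
Qed.

Lemma is_derive_mul (R : realType) (g h : R -> R) (s dg dh : R) :
  is_derive s 1 g dg -> is_derive s 1 h dh ->
  is_derive s 1 (fun x => g x * h x) (dg * h s + g s * dh).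
Proof.
move=> dgs dhs; have -> : (fun x => g x * h x) = g * h by [].
by apply: is_derive_eq; rewrite /GRing.scale /=; ring.
Qed.

(** Near a point of an open set the two functions agree, and the derivative is local. This is what
    allows identities known only on [I] to be differentiated. *)
Lemma is_derive_open (R : realType) (V : normedModType R) (I : set R)
    (g h : R -> V) (s : R) (dh : V) : open I -> I s ->
  (forall x, I x -> g x = h x) -> is_derive s 1 h dh -> is_derive s 1 g dh.
Proof.
move=> openI Is ghE; apply: near_eq_is_derive.
have := open_nbhs_nbhs (conj openI Is); apply: filterS => x Ix.
by rewrite ghE.
Qed.

Lemma is_derive1E (R : realType) (V : normedModType R) (g : R -> V) (s : R)
  (dg : V) : is_derive s 1 g dg -> derive1 g s = dg.
Proof. by move=> [_ <-]; rewrite derive1E. Qed.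

Lemma derivable_is_derive1 (R : realType) (V : normedModType R) (g : R -> V)
  (s : R) : derivable g s 1 -> is_derive s 1 g (derive1 g s).
Proof. by move=> ?; rewrite derive1E; exact: derivableP. Qed.

Lemma unit_speed_frenet_T (R : realType) (I : set R) (g : R -> 'rV[R]_3)
  (s : R) : unit_speed I g -> I s -> frenet_T g s = derive1 g s.
Proof. by move=> g1 Is; rewrite /frenet_T g1 // invr1 scale1r. Qed.

(** * Velocity and acceleration of the associated curve in the frame of [alpha] *)

Section associated_curve.
Variables (R : realType) (I : set R) (alpha alphas : R -> 'rV[R]_3).
Variables (kappa tau lambda : R -> R) (e f : R).
Hypothesis openI : open I.
Hypothesis alpha_frenet : frenet_curve I alpha.
Hypothesis alpha_unit : unit_speed I alpha.
Hypothesis alpha_eqs : frenet_equations I alpha kappa tau.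
Hypothesis tau_derivable : forall s : R, I s -> derivable tau s 1.
Hypothesis alphas_frenet : frenet_curve I alphas.
Hypothesis lambda_derivable : twice_derivable I lambda.
Hypothesis alphasE : forall s : R, I s ->
  alphas s = alpha s + lambda s *: frenet_B alpha s.
Hypothesis assoc : BR_associated I e f alpha alphas.

Local Notation T := (frenet_T alpha).
Local Notation N := (frenet_N alpha).
Local Notation B := (frenet_B alpha).
Local Notation X := (coefX kappa tau lambda).
Local Notation Y := (coefY kappa tau lambda).
Local Notation Z := (coefZ kappa tau lambda).

Let frameI s (Is : I s) : is_frame (T s) (N s) (B s) :=
  frenet_curve_frame alpha_frenet Is.

(* [frenet_N] is defined as [B `x` T], with [B] along [alpha' `x` alpha''],
   which forces the positive sign. *)
Lemma curvature_gt0 s : I s -> 0 < kappa s.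
Proof.
move=> Is; have [_ crossN0] := alpha_frenet.
have [dT _ _] := alpha_eqs Is; have {}crossN0 := crossN0 _ Is.
have TE x : I x -> derive1 alpha x = T x.
  by move=> Ix; rewrite (unit_speed_frenet_T alpha_unit).
have alpha2E : derive1n 2 alpha s = kappa s *: N s.
  exact: is_derive1E (is_derive_open openI Is TE dT).
have [TN _ _] := frame_cross (frameI Is).
have crossE : cross (derive1 alpha s) (derive1n 2 alpha s) = kappa s *: B s.
  by rewrite TE // alpha2E -[T s]scale1r crossZZ mul1r TN.
have [_ BB _ _] := frameI Is.
have w_gt0 := enorm_gt0 crossN0.
set w := enorm _ in w_gt0.
have kB : w^-1 * kappa s *: B s = B s by rewrite -scalerA -crossE.
have : w^-1 * kappa s = 1.
  by rewrite -[RHS](BB) -{1}kB -[X in dot _ X]scale1r dotZZ BB !mulr1.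
by move=> wk; rewrite -(mulVKf (lt0r_neq0 w_gt0) (kappa s)) wk mulr1.
Qed.

Lemma derive1_alphas s : I s ->
  derive1 alphas s =
  1 *: T s + (- (lambda s * tau s)) *: N s + derive1 lambda s *: B s.
Proof.
move=> Is; have [_ _ dB] := alpha_eqs Is.
have [dlambda _] := lambda_derivable Is.
have [[dalpha _] _] := (alpha_frenet.1 s Is, tt).
apply: is_derive1E; apply: (is_derive_open openI Is alphasE).
apply: is_derive_eq.
  apply: is_deriveD; first exact: derivable_is_derive1.
  by apply: is_derive_scale; first exact: derivable_is_derive1.
rewrite (unit_speed_frenet_T alpha_unit Is).
by rewrite scalerA mulrN scale1r -addrA.
Qed.

Let dlt s : R := derive1 lambda s * tau s + lambda s * derive1 tau s.

Lemma is_derive_lambda_tau s : I s ->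
  is_derive s 1 (fun x => lambda x * tau x) (dlt s).
Proof.
move=> Is; have [dlambda _] := lambda_derivable Is.
exact: is_derive_mul (derivable_is_derive1 dlambda)
  (derivable_is_derive1 (tau_derivable Is)).
Qed.

(** Stated for arbitrary vectors in place of [T], [N], [B], so that it is a plain entrywise
    polynomial identity. *)
Let derive2_combination (a b c : 'rV[R]_3) (l k t l1 l2 d : R) :
  1 *: (k *: b) + 0 *: a + (- (l * t) *: (- k *: a + t *: c) + - d *: b)
    + (l1 *: (- t *: b) + l2 *: c) =
  (l * t * k) *: a + (k - l1 * t - d) *: b + (l2 - l * t ^+ 2) *: c.
Proof. row3_ring. Qed.

Lemma derive2_alphas s : I s ->
  derive1n 2 alphas s =
  (lambda s * tau s * kappa s) *: T s
  + (kappa s - derive1 lambda s * tau s - dlt s) *: N s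
  + (derive1n 2 lambda s - lambda s * tau s ^+ 2) *: B s.
Proof.
move=> Is; have [dT dN dB] := alpha_eqs Is.
have [_ dlambda1] := lambda_derivable Is.
apply: is_derive1E; apply: (is_derive_open openI Is derive1_alphas).
have dltN : is_derive s 1 (fun x => - (lambda x * tau x)) (- dlt s).
  by apply: is_deriveN; exact: is_derive_lambda_tau.
have d1 := is_derive_scale (is_derive_cst (1 : R) s (1 : R)) dT.
have d2 := is_derive_scale dltN dN.
have d3 := is_derive_scale (derivable_is_derive1 dlambda1) dB.
apply: is_derive_eq (is_deriveD (is_deriveD d1 d2) d3) _.
exact: derive2_combination.
Qed.

Lemma cross_alphas s : I s ->
  cross (derive1 alphas s) (derive1n 2 alphas s) =
  X s *: T s + Y s *: N s + Z s *: B s.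
Proof.
move=> Is; rewrite (derive1_alphas Is) (derive2_alphas Is) (cross_frame (frameI Is)).
congr (_ *: _ + _ *: _ + _ *: _).
- by rewrite /coefX /dlt; ring.
- by rewrite /coefY; ring.
- by rewrite /coefZ /dlt; ring.
Qed.

(** * Parallelism of [Rstar] and [B] as scalar equations *)

Lemma Rstar_parallel s : I s -> exists c, Rstar e f alphas s = c *: B s.
Proof.
move=> Is; have [_ dep] := assoc; have := dep s Is.
have [_ BB _ _] := frameI Is.
have B0 : B s != 0.
  by apply/eqP => B0; move: BB; rewrite B0 dotE !mxE; lra.
(* With the nonzero vector [B s] placed last, dependence means that [Rstar] lies in its span. *)
rewrite (@perm_free _ _ _ [:: Rstar e f alphas s; B s]); last first.
  by rewrite (perm_catC [:: _] [:: _]).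
by rewrite free_cons seq1_free B0 andbT negbK span_seq1 => /vlineP.
Qed.

Let speed s : R := Num.sqrt (1 + (lambda s * tau s) ^+ 2 + derive1 lambda s ^+ 2).
Let cnorm s : R := Num.sqrt (X s ^+ 2 + Y s ^+ 2 + Z s ^+ 2).

Lemma enorm_derive1_alphas s : I s -> enorm (derive1 alphas s) = speed s.
Proof.
move=> Is; rewrite (derive1_alphas Is) (enorm_frame (frameI Is)).
by rewrite expr1n sqrrN.
Qed.

Lemma enorm_cross_alphas s : I s ->
  enorm (cross (derive1 alphas s) (derive1n 2 alphas s)) = cnorm s.
Proof. by move=> Is; rewrite (cross_alphas Is) (enorm_frame (frameI Is)). Qed.

Lemma cnorm_gt0 s : I s -> 0 < cnorm s.
Proof.
move=> Is; rewrite -enorm_cross_alphas // enorm_gt0 //.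
by have [_ ->] := alphas_frenet.
Qed.

Lemma sqr_cnorm s : cnorm s ^+ 2 = X s ^+ 2 + Y s ^+ 2 + Z s ^+ 2.
Proof. by rewrite sqr_sqrtr // !addr_ge0 ?sqr_ge0. Qed.

Lemma speed_gt0 s : 0 < speed s.
Proof. by rewrite sqrtr_gt0; nra. Qed.

Lemma sqr_speed s : speed s ^+ 2 = 1 + (lambda s * tau s) ^+ 2 + derive1 lambda s ^+ 2.
Proof. by rewrite sqr_sqrtr //; nra. Qed.

Lemma frenet_T_alphas s : I s -> frenet_T alphas s =
  (speed s)^-1 *: (1 *: T s + (- (lambda s * tau s)) *: N s
               + derive1 lambda s *: B s).
Proof.
by move=> Is; rewrite {1}/frenet_T (enorm_derive1_alphas Is) (derive1_alphas Is).
Qed.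

Lemma frenet_B_alphas s : I s -> frenet_B alphas s =
  (cnorm s)^-1 *: (X s *: T s + Y s *: N s + Z s *: B s).
Proof.
by move=> Is; rewrite {1}/frenet_B (enorm_cross_alphas Is) (cross_alphas Is).
Qed.

(** These are the vanishing [T] and [N] components of [Rstar], with the denominators [speed s] and
    [cnorm s] cleared. The [B] component only determines the factor [c]. *)
Lemma associated_coords s : I s ->
  e * cnorm s + f * X s * speed s = 0 /\
  f * Y s * speed s = e * (lambda s * tau s) * cnorm s.
Proof.
move=> Is; have [c] := Rstar_parallel Is.
have [ef0 _] := assoc.
rewrite /Rstar (frenet_T_alphas Is) (frenet_B_alphas Is).
have : 0 < Num.sqrt (e ^+ 2 + f ^+ 2).
  rewrite sqrtr_gt0 lt_def addr_ge0 ?sqr_ge0 // andbT.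
  by apply/eqP => ef; apply: ef0; congr (_, _); nra.
set rho := Num.sqrt _ => rho_gt0.
have [v0 W0] := (speed_gt0 s, cnorm_gt0 Is).
set m := lambda s * tau s; set l' := derive1 lambda s => RB.
have [] := @frame_inj _ _ _ _ (frameI Is)
  (e / speed s + f * X s / cnorm s) (- (e * m / speed s) + f * Y s / cnorm s)
  (e * l' / speed s + f * Z s / cnorm s) 0 0 (rho * c).
  have := congr1 (fun u => rho *: u) RB.
  rewrite scalerA mulfV ?gt_eqF // scale1r => RB'.
  rewrite -scalerA !scale0r !add0r -RB'.
  move: (T s) (N s) (B s) => Ts Ns Bs.
  by apply/rowP => i; rewrite !mxE; ring.
move=> hT hN _; split.
  transitivity ((e / speed s + f * X s / cnorm s) * (speed s * cnorm s)).
    by field; rewrite !gt_eqF.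
  by rewrite hT mul0r.
apply/eqP; rewrite -subr_eq0; apply/eqP.
transitivity ((- (e * m / speed s) + f * Y s / cnorm s) * (speed s * cnorm s)).
  by field; rewrite !gt_eqF.
by rewrite hN mul0r.
Qed.

(** With [f = 0], [Rstar] would be a multiple of the tangent of [alphas], whose [T] component is
    never zero; then [e = 0] as well, which is excluded. *)
Lemma f_neq0 s : I s -> f != 0.
Proof.
move=> Is; have [ef0 _] := assoc; apply/eqP => f0.
have [eW _] := associated_coords Is; apply: ef0; rewrite f0; congr (_, _).
move: eW; rewrite f0 !mul0r addr0 => /eqP; rewrite mulf_eq0.
by rewrite (gt_eqF (cnorm_gt0 Is)) orbF => /eqP.
Qed.

(** Substituting the first coordinate relation into the second eliminates [e]; the common factor
    [f * speed s] is nonzero. *)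
Lemma coefYE s : I s -> Y s = - (lambda s * tau s) * X s.
Proof.
move=> Is; have [hT hN] := associated_coords Is.
have fv0 : f * speed s != 0 by rewrite mulf_neq0 ?(f_neq0 Is) ?(gt_eqF (speed_gt0 s)).
apply: (mulfI fv0).
by have := congr1 ( *%R (lambda s * tau s)) hT; rewrite mulr0; lra.
Qed.

(* The tangent of [alphas] makes a constant angle with [B]; squaring avoids
   tracking the sign of [Rstar] relative to [B]. *)
Lemma constant_slope s : I s ->
  f ^+ 2 * derive1 lambda s ^+ 2 = e ^+ 2 * (1 + (lambda s * tau s) ^+ 2).
Proof.
move=> Is; have [hT hN] := associated_coords Is.
have W2 := sqr_cnorm s; have v2 := sqr_speed s; have YE := coefYE Is.
(* The cross product of velocity and acceleration is orthogonal to the velocity. *)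
have orth : X s - lambda s * tau s * Y s + derive1 lambda s * Z s = 0.
  by rewrite /coefX /coefY /coefZ; ring.
have W0 := cnorm_gt0 Is; have v0 := speed_gt0 s.
move: orth W2 v2 YE hT; move: (X s) (Y s) (Z s) (cnorm s) (speed s) W0 v0.
move: (lambda s * tau s) (derive1 lambda s) => m l' x y z w u w0 u0 + + + + hT.
move=> orth w2 u2 yE; subst y.
have q0 : 0 < 1 + m ^+ 2 + l' ^+ 2 by nra.
have w2_0 : w ^+ 2 != 0 by rewrite sqrf_eq0 gt_eqF.
have efx : e ^+ 2 * w ^+ 2 = f ^+ 2 * x ^+ 2 * u ^+ 2.
  have -> : e ^+ 2 * w ^+ 2 = (e * w) ^+ 2 by ring.
  by rewrite (_ : e * w = - (f * x * u)); [ring | lra].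
have lz : l' * z = - x * (1 + m ^+ 2) by lra.
have lz2 : l' ^+ 2 * z ^+ 2 = x ^+ 2 * (1 + m ^+ 2) ^+ 2.
  by rewrite -exprMn lz; ring.
(* After multiplication by [w ^+ 2], both sides equal [f^2 x^2 (1 + m^2) (1 + m^2 + l'^2)]. *)
apply: (mulIf w2_0).
rewrite [RHS]mulrAC efx u2 -mulrA w2.
by have := congr1 ( *%R (f ^+ 2)) lz2; lra.
Qed.

(** Half the derivative of [constant_slope], which holds on the whole open set [I]. *)
Lemma derive_constant_slope s : I s ->
  f ^+ 2 * (derive1 lambda s * derive1n 2 lambda s) =
  e ^+ 2 * (lambda s * tau s * dlt s).
Proof.
move=> Is; have [_ dlambda1] := lambda_derivable Is.
have dl1 := derivable_is_derive1 dlambda1.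
have dm := is_derive_lambda_tau Is.
have sq (g : R -> R) dg : is_derive s 1 g dg ->
    is_derive s 1 (fun x => g x * g x) (dg * g s + g s * dg).
  by move=> d; exact: is_derive_mul.
have dL := is_derive_mul (is_derive_cst (f ^+ 2) s (1 : R)) (sq _ _ dl1).
have dR := is_derive_mul (is_derive_cst (e ^+ 2) s (1 : R))
  (is_deriveD (is_derive_cst (1 : R) s (1 : R)) (sq _ _ dm)).
have := is_derive1E (is_derive_open openI Is _ dR).
rewrite (_ : derive1n 2 lambda s = derive1 (derive1 lambda) s) //.
have squaredE x : I x ->
    cst (f ^+ 2) x * (derive1 lambda x * derive1 lambda x) =
    cst (e ^+ 2) x * (cst 1 x + lambda x * tau x * (lambda x * tau x)).
  by move=> Ix /=; have := constant_slope Ix; rewrite !expr2.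
move=> /(_ _ squaredE); rewrite (is_derive1E dL) /=.
move: (dlt s) => d; move: (derive1 (derive1 lambda) s) => l2; lra.
Qed.

(** Eliminates [e] and [f] between [constant_slope] and its derivative. This divides by
    [f^2 lambda'], hence the split on [e]: if [e = 0], then [lambda'] vanishes on all of [I] and so
    does [lambda'']; otherwise [lambda'] is nonzero. *)
Lemma derive2_lambdaE s : I s ->
  (1 + (lambda s * tau s) ^+ 2) * derive1n 2 lambda s =
  derive1 lambda s * (lambda s * tau s) * dlt s.
Proof.
move=> Is; have f0 := f_neq0 Is.
have f2_0 : f ^+ 2 != 0 by rewrite sqrf_eq0.
have slope x (Ix : I x) := constant_slope Ix.
have dslope := derive_constant_slope Is.
have [e0|e0] := eqVneq e 0.
  have l1_0 x : I x -> derive1 lambda x = cst 0 x.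
    move=> Ix; have /eqP := slope x Ix; rewrite e0 expr0n mul0r.
    by rewrite mulf_eq0 (negPf f2_0) sqrf_eq0 => /eqP.
  have -> : derive1n 2 lambda s = 0.
    exact: is_derive1E (is_derive_open openI Is l1_0 (is_derive_cst (0 : R) s (1 : R))).
  by rewrite l1_0 // mulr0 !mul0r.
have l1_0 : derive1 lambda s != 0.
  have : e ^+ 2 * (1 + (lambda s * tau s) ^+ 2) != 0.
    by rewrite mulf_neq0 ?sqrf_eq0 //; apply/lt0r_neq0; nra.
  by rewrite -slope // mulf_eq0 negb_or !sqrf_eq0 => /andP[].
apply: (mulfI (mulf_neq0 f2_0 l1_0)).
have sl := slope s Is.
move: sl dslope; move: (derive1n 2 lambda s) (dlt s) => l2 d.
move: (lambda s * tau s) (derive1 lambda s) => m l1 sl dslope.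
transitivity ((1 + m ^+ 2) * (f ^+ 2 * (l1 * l2))); first by ring.
rewrite dslope; transitivity (e ^+ 2 * (1 + m ^+ 2) * (m * d)); first by ring.
by rewrite -sl; ring.
Qed.

(** * Vanishing of [lambda tau] and of its consequences *)

Lemma lambda_tau_eq0 s : I s -> lambda s * tau s = 0.
Proof.
move=> Is; have := derive2_lambdaE Is.
have := coefYE Is; rewrite /coefX /coefY /dlt.
move: (derive1n 2 lambda s) (derive1 lambda s) (derive1 tau s) => l2 l1 t1.
move: (lambda s) (tau s) (kappa s) => l t k YE l2E.
(* In [YE] the curvature terms cancel, leaving an expression for [(1 + (l t)^2) l2]. Comparing it
   with [l2E] cancels the terms in [t1] as well. *)
have : l * t ^+ 2 * (1 + (l * t) ^+ 2 + l1 ^+ 2) = 0 by lra.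
move=> /eqP; rewrite mulf_eq0 [X in _ || X]gt_eqF ?orbF; last by nra.
by rewrite expr2 mulrA mulf_eq0 => /orP[/eqP //|/eqP ->]; rewrite mulr0.
Qed.

(** The derivative of [lambda tau] is zero on [I]. Multiplying its product-rule expansion by
    [lambda] kills the term in [lambda' tau] and leaves [lambda^2 tau' = 0], so the two terms vanish
    separately. *)
Lemma lambda_derive_tau_eq0 s : I s ->
  lambda s * derive1 tau s = 0 /\ derive1 lambda s * tau s = 0.
Proof.
move=> Is; have lt0 := lambda_tau_eq0 Is.
have : derive1 (fun x => lambda x * tau x) s = 0.
  apply: is_derive1E (is_derive_open openI Is _ (is_derive_cst (0 : R) s (1 : R))).
  exact: lambda_tau_eq0.
rewrite (is_derive1E (is_derive_lambda_tau Is)) /dlt.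
move: (derive1 lambda s) (derive1 tau s) (lambda s) (tau s) lt0 => l1 t1 l t.
move=> lt0 d0; have lt1 : l * t1 = 0.
  have : l ^+ 2 * t1 = 0 
    by have := congr1 ( *%R l) d0; have := congr1 ( *%R l1) lt0; lra.
  by move=> /eqP; rewrite mulf_eq0 sqrf_eq0 => /orP[]/eqP->; rewrite (mul0r, mulr0).
by split=> //; move: d0; rewrite lt1 addr0.
Qed.

(** * Reduced coefficients, norms and slope *)

Lemma coefsE s : I s ->
  [/\ X s = - derive1 lambda s * kappa s, Y s = 0 & Z s = kappa s].
Proof.
move=> Is; have lt0 := lambda_tau_eq0 Is.
have [lt1 l1t] := lambda_derive_tau_eq0 Is.
have Z_ : Z s = kappa s.
  by rewrite /coefZ -exprMn lt0 mulNr lt1 -mulrA l1t; ring.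
have X_ : X s = - derive1 lambda s * kappa s.
  by rewrite /coefX !mulNr lt0 lt1 -(mulrA 2) l1t; ring.
by split=> //; rewrite coefYE // lt0 oppr0 mul0r.
Qed.

Lemma speedE s : I s -> speed s = Num.sqrt (1 + derive1 lambda s ^+ 2).
Proof. by move=> Is; rewrite /speed lambda_tau_eq0 // expr0n addr0. Qed.

(** The sum under the root is [kappa^2 (1 + lambda'^2)], and positivity of [kappa] lets it leave the
    root without an absolute value. *)
Lemma cnormE s : I s -> cnorm s = kappa s * speed s.
Proof.
move=> Is; have k0 := curvature_gt0 Is; have [X_ Y_ Z_] := coefsE Is.
rewrite speedE // /cnorm X_ Y_ Z_ -[in RHS](gtr0_norm k0) -sqrtr_sqr.
by rewrite -sqrtrM ?sqr_ge0 //; congr Num.sqrt; ring.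
Qed.

(** Recovers the sign lost in [constant_slope]: the first coordinate relation is linear in [e] and
    [f], with nonzero common factor [kappa s * speed s]. *)
Lemma slopeE s : I s -> e = f * derive1 lambda s.
Proof.
move=> Is; have [X_ _ _] := coefsE Is.
have [+ _] := associated_coords Is; rewrite X_ cnormE // => efkv.
have kv0 : kappa s * speed s != 0.
  by rewrite mulf_neq0 // gt_eqF // ?speed_gt0 // curvature_gt0.
by apply: (mulIf kv0); lra.
Qed.

(** Substituting [e = f lambda'] makes [f^2] a factor under the root. The resulting absolute value
    is the source of [Num.sg f] in the final formulas. *)
Lemma sqrt_efE s : I s -> Num.sqrt (e ^+ 2 + f ^+ 2) = `|f| * speed s.
Proof.
move=> Is; rewrite (slopeE Is) speedE // -sqrtr_sqr -sqrtrM ?sqr_ge0 //.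
by congr Num.sqrt; ring.
Qed.

Lemma sgr_scale s : I s -> Num.sg f * (f / (`|f| * speed s)) = (speed s)^-1.
Proof.
move=> Is; have f0 : `|f| != 0 by rewrite normr_eq0 (f_neq0 Is).
have v0 := lt0r_neq0 (speed_gt0 s).
by rewrite mulrA -normrEsg; field; rewrite f0 v0.
Qed.

(** * The frame of the associated curve *)

Lemma associated_frenet_T s : I s ->
  frenet_T alphas s =
  Num.sg f *: ((Num.sqrt (e ^+ 2 + f ^+ 2))^-1 *:
    ((f / Num.sqrt (1 + lambda s ^+ 2 * tau s ^+ 2)) *: T s
     - (lambda s * tau s * f / Num.sqrt (1 + lambda s ^+ 2 * tau s ^+ 2)) *: N s
     + e *: B s)).
Proof.
(* Since [lambda tau = 0], the inner roots are 1 and both sides reduce to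
   [(T + lambda' B) / speed]. *)
move=> Is; rewrite (sqrt_efE Is) (frenet_T_alphas Is) -exprMn (lambda_tau_eq0 Is).
rewrite expr0n addr0 sqrtr1 divr1 !mul0r oppr0 scale0r subr0 addr0.
rewrite [in RHS](slopeE Is) -(sgr_scale Is).
rewrite scale1r -(scalerA f) -scalerDr !scalerA; congr (_ *: _).
by rewrite -mulrA (mulrC f).
Qed.

Lemma associated_frenet_B s : I s ->
  frenet_B alphas s =
  Num.sg f *: ((f / Num.sqrt (e ^+ 2 + f ^+ 2)) *:
    ((X s / Z s) *: T s + (Y s / Z s) *: N s + B s)).
Proof.
move=> Is; have k0 := lt0r_neq0 (curvature_gt0 Is).
have [XE YE ZE] := coefsE Is.
(* Both sides reduce to [(- lambda' T + B) / speed]. *)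
rewrite (sqrt_efE Is) scalerA (sgr_scale Is) (frenet_B_alphas Is) (cnormE Is).
rewrite XE YE ZE mulfK // mul0r scale0r !addr0 (mulrC _ (kappa s)).
rewrite -scalerA -scalerDr scalerA.
by congr (_ *: _); rewrite invfM mulrAC mulVf // mul1r.
Qed.

(** Both sides equal [N s]: the [T] coefficients vanish and the [N] coefficients are both 1, on the
    right after cancelling [lambda']. *)
Lemma associated_frenet_N s : I s -> derive1 lambda s != 0 ->
  frenet_N alphas s =
  (e * f / (e ^+ 2 + f ^+ 2)) *:
    (((Y s * derive1 lambda s + Z s * lambda s * tau s)
        / (Z s * derive1 lambda s)) *: T s
     + ((- X s * derive1 lambda s + Z s) / (Z s * derive1 lambda s)) *: N s).
Proof.
move=> Is l1_0; have k0 := lt0r_neq0 (curvature_gt0 Is).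
have [XE YE ZE] := coefsE Is; have f0 := f_neq0 Is.
have v0 := lt0r_neq0 (speed_gt0 s).
have v2 : speed s ^+ 2 = 1 + derive1 lambda s ^+ 2.
  by rewrite sqr_speed (lambda_tau_eq0 Is) expr0n addr0.
have q0 : 1 + derive1 lambda s ^+ 2 != 0 by rewrite -v2 sqrf_eq0.
rewrite /frenet_N (frenet_B_alphas Is) (frenet_T_alphas Is) crossZZ.
rewrite (cross_frame (frameI Is)) (cnormE Is) XE YE ZE (lambda_tau_eq0 Is).
rewrite -(mulrA (kappa s)) (lambda_tau_eq0 Is) [in RHS](slopeE Is).
rewrite !(mul0r, mulr0, addr0, oppr0, subr0, scale0r, add0r) !scalerA.
move: (derive1 lambda s) (kappa s) (speed s) l1_0 k0 v0 v2 q0.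
move=> l1 k u l1_0 k0 u0 u2 q0; congr (_ *: _); transitivity (1 : R).
  transitivity ((1 + l1 ^+ 2) / u ^+ 2); first by field; rewrite k0 u0.
  by rewrite u2 divff.
have fq0 : (f * l1) ^+ 2 + f ^+ 2 != 0.
  rewrite (_ : _ + _ = f ^+ 2 * (1 + l1 ^+ 2)); last by ring.
  by rewrite mulf_neq0 // sqrf_eq0.
by field; rewrite fq0 k0 l1_0.
Qed.

End associated_curve.

(* Two corrections to the formulas as they are usually printed:
   - N* = B* x T* is given with coefficient ef/(e^2+f^2) and with -X lambda' + Z
     (printed: ef/sqrt(e^2+f^2) and -X lambda + Z, which is not a unit vector);
   - T* and B* carry the sign of f: (e, f) and (-e, -f) define the same
     associated curves, while T* and B* do not depend on that choice.  For
     f > 0 the formulas are the printed ones.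
   N* is asserted where its denominator lambda' does not vanish. *)
Theorem theorem5p5 (R : realType) (I : set R) (alpha alphas : R -> 'rV[R]_3)
    (kappa tau lambda : R -> R) (e f : R)
    (openI : open I) (intervalI : is_interval I)
    (alpha_frenet : frenet_curve I alpha)
    (alpha_unit : unit_speed I alpha)
    (alpha_eqs : frenet_equations I alpha kappa tau)
    (tau_derivable : forall s : R, I s -> derivable tau s 1)
    (alphas_frenet : frenet_curve I alphas)
    (lambda_derivable : twice_derivable I lambda)
    (alphasE : forall s : R, I s ->
       alphas s = alpha s + lambda s *: frenet_B alpha s)
    (assoc : BR_associated I e f alpha alphas) :
  forall s : R, I s ->
    let T := frenet_T alpha s in
    let N := frenet_N alpha s in
    let B := frenet_B alpha s in
    let X := coefX kappa tau lambda s in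
    let Y := coefY kappa tau lambda s in
    let Z := coefZ kappa tau lambda s in
    let l := lambda s in
    let l' := derive1 lambda s in
    let t := tau s in
    [/\ frenet_T alphas s =
          Num.sg f *: ((Num.sqrt (e ^+ 2 + f ^+ 2))^-1 *:
            ((f / Num.sqrt (1 + l ^+ 2 * t ^+ 2)) *: T
             - (l * t * f / Num.sqrt (1 + l ^+ 2 * t ^+ 2)) *: N
             + e *: B)),
        l' != 0 ->
        frenet_N alphas s =
          (e * f / (e ^+ 2 + f ^+ 2)) *:
            (((Y * l' + Z * l * t) / (Z * l')) *: T
             + ((- X * l' + Z) / (Z * l')) *: N)
      & frenet_B alphas s =
          Num.sg f *: ((f / Num.sqrt (e ^+ 2 + f ^+ 2)) *:
            ((X / Z) *: T + (Y / Z) *: N + B))].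
Proof.
move=> s Is /=; split.
- exact: (associated_frenet_T openI alpha_frenet alpha_unit alpha_eqs
    tau_derivable alphas_frenet lambda_derivable alphasE assoc Is).
- exact: (associated_frenet_N openI alpha_frenet alpha_unit alpha_eqs
    tau_derivable alphas_frenet lambda_derivable alphasE assoc Is).
- exact: (associated_frenet_B openI alpha_frenet alpha_unit alpha_eqs
    tau_derivable alphas_frenet lambda_derivable alphasE assoc Is).
Qed.
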